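(* For Independent Set in the Late Accept model, the competitive ratio is $n/\Theta(1)$, where $n$ is the number of vertices of the input graph, in the following sense. (i) For every online algorithm $\mathrm{ALG}$ in the Late Accept model there is a constant $b>0$ such that the strict competitive ratio of $\mathrm{ALG}$ is at least $n/b$, i.e., for every integer $n\ge 1$, every real $c\ge 0$ with $\mathrm{OPT}(\sigma)\le c\,\mathrm{ALG}(\sigma)$ for all inputs $\sigma$ with $n$ vertices satisfies $c\ge n/b$. (ii) For every constant $b>0$ there is an online algorithm $\mathrm{ALG}$ in the Late Accept model that is $n/b$-competitive for graphs with at least $b$ vertices, i.e., there is a constant $\alpha$ such that $\mathrm{OPT}(\sigma)\le \frac{n}{b}\,\mathrm{ALG}(\sigma)+\alpha$ for every input $\sigma$ with $n\ge b$ vertices.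
   Context: Online Independent Set (vertex arrival). An input $\sigma$ is a finite simple undirected graph $G=(V,E)$ together with an ordering of its vertices. Vertices arrive one by one in this order; when a vertex arrives, all edges between it and previously arrived vertices are revealed. All online algorithms are deterministic: each decision depends only on the part of the input revealed so far (in particular $n=|V|$ is not known in advance). After each arrival the algorithm maintains a set of currently accepted vertices, which must be an independent set of the graph revealed so far. $\mathrm{ALG}(\sigma)$ is the number of accepted vertices at the end of the input, and $\mathrm{OPT}(\sigma)$ is the maximum cardinality of an independent set of $G$; the objective is maximization. Late Accept model: in each step the algorithm may accept the newly arrived vertex and/or any earlier vertices that are not yet accepted; acceptance is irrevocable, i.e., an accepted vertex can never be removed. *)

(* Defs.v *)
From mathcomp Require Import all_boot all_order all_algebra.
From mathcomp Require Import reals.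

Set Implicit Arguments.
Unset Strict Implicit.
Unset Printing Implicit Defensive.

(* An input with n vertices: a simple undirected graph, given by its set of
   two-element edges, whose vertex i : 'I_n is the one arriving at step i + 1.
   The arrival order is thus the natural order of 'I_n. *)
Record input (n : nat) := Input {
  edges : {set {set 'I_n}};
  edges_simple : [forall e in edges, #|e| == 2]
}.

Definition earlier (n : nat) : 'I_n -> 'I_n.+1 := widen_ord (leqnSn n).

Definition prefix_edges (n : nat) (G : input n.+1) : {set {set 'I_n}} :=
  [set e : {set 'I_n} | @earlier n @: e \in edges G].

Lemma prefix_edges_simple (n : nat) (G : input n.+1) :
  [forall e in prefix_edges G, #|e| == 2].
Proof.
apply/forall_inP => e; rewrite inE => eG.
have /forall_inP /(_ _ eG) := edges_simple G.
by rewrite card_imset // => i j /(congr1 val) /= ij; apply: val_inj.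
Qed.

(* What had been revealed before the last arrival: the induced subgraph on all
   vertices but the last. *)
Definition prefix (n : nat) (G : input n.+1) : input n :=
  Input (prefix_edges_simple G).

Definition independent (n : nat) (G : input n) (S : {set 'I_n}) : bool :=
  [forall e in edges G, ~~ (e \subset S)].

Definition OPT (n : nat) (G : input n) : nat :=
  \max_(S : {set 'I_n} | independent G S) #|S|.

(* A deterministic online algorithm is determined by the set of accepted
   vertices it holds after each arrival, as a function of the graph revealed so
   far. That graph, with its vertices in arrival order, is itself an input (on
   k vertices after k arrivals), and it also determines all earlier decisions.
   Since [accepted] is only ever given the revealed graph, the algorithm does
   not know the length of the full input. *)
Record late_accept_algorithm := LateAcceptAlgorithm {
  accepted : forall n : nat, input n -> {set 'I_n};
  accepted_independent :
    forall (n : nat) (G : input n), independent G (accepted G);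
  accepted_irrevocable :
    forall (n : nat) (G : input n.+1),
      @earlier n @: accepted (prefix G) \subset accepted G
}.

Definition ALG (A : late_accept_algorithm) (n : nat) (G : input n) : nat :=
  #|accepted A G|.

(* Main.v *)
Require Import Defs.
From mathcomp Require Import all_boot all_order all_algebra.
From mathcomp Require Import boolp reals.
Import Order.TTheory GRing.Theory Num.Theory.
Local Open Scope ring_scope.

(** Lower bound: feed the algorithm isolated vertices.  If it never accepts one,
    its ratio is unbounded for every n.  Otherwise it holds some vertex v after
    m arrivals, and from then on every new vertex is made adjacent to v only: at
    most the first m vertices can be accepted, while the n - m new ones are
    independent.

    Upper bound: accept nothing until an independent set of size k >= b exists,
    accept that set, and stop.  Either OPT < k, which the additive constant
    absorbs, or ALG >= b and OPT <= n suffices. *)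

Lemma input_inj n (G H : input n) : edges G = edges H -> G = H.
Proof.
case: G H => [E sE] [F sF] /= EF; rewrite -{}EF in sF *.
by rewrite (bool_irrelevance sE sF).
Qed.

Lemma earlier_inj n : injective (@earlier n).
Proof. by move=> i j /(congr1 val) /= ij; apply: val_inj. Qed.

Lemma independent0 n (G : input n) : independent G set0.
Proof.
apply/forall_inP => e eG; rewrite subset0 -cards_eq0.
by have /forall_inP /(_ e eG) /eqP -> := edges_simple G.
Qed.

Lemma OPT_ge n (G : input n) (S : {set 'I_n}) :
  independent G S -> (#|S| <= OPT G)%N.
Proof. exact: (@leq_bigmax_cond _ (independent G) (fun T => #|T|)). Qed.

Lemma OPT_le n (G : input n) : (OPT G <= n)%N.
Proof.
by apply/bigmax_leqP => S _; rewrite -[leqRHS]card_ord; apply: max_card.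
Qed.

Lemma OPT_witness n (G : input n) k :
  (k <= OPT G)%N -> exists2 S, independent G S & (k <= #|S|)%N.
Proof.
have [|S indS maxS] := @eq_bigmax_cond _ (independent G) (fun T => #|T|).
  by apply/card_gt0P; exists set0; apply: independent0.
by rewrite /OPT maxS; exists S.
Qed.

(** Every edge of [G] between earlier vertices is already an edge of the prefix, so a new arrival
    cannot spoil a set held before it. *)
Lemma independent_earlier n (G : input n.+1) (S : {set 'I_n}) :
  independent (Defs.prefix G) S -> independent G (@earlier n @: S).
Proof.
move=> /forall_inP indS; apply/forall_inP => e eG; apply/negP => eS.
have [T TS eT] : exists2 T : {set 'I_n}, T \subset S & e = @earlier n @: T.
  exists (@earlier n @^-1: e :&: S); first exact: subsetIr.
  apply/setP => x; apply/idP/imsetP => [xe|[y]]; last first.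
    by rewrite !inE => /andP[ye _] ->.
  have /imsetP[y yS xy] := subsetP eS x xe.
  by exists y; rewrite // !inE -xy xe.
by have := indS T; rewrite inE -eT => /(_ eG); rewrite TS.
Qed.

Lemma card_below n m : (#|[set i : 'I_n | (i < m)%N]| <= m)%N.
Proof.
rewrite cardE -(size_map val) -[leqRHS](size_iota 0); apply: uniq_leq_size.
  by rewrite map_inj_uniq ?enum_uniq //; apply: val_inj.
by move=> _ /mapP[i + ->]; rewrite mem_enum inE mem_iota.
Qed.

Section LowerBound.

Lemma no_edges_simple n : [forall e in (set0 : {set {set 'I_n}}), #|e| == 2].
Proof. by apply/forall_inP => e; rewrite inE. Qed.

Definition edgeless n : input n := Input (no_edges_simple n).

Lemma OPT_edgeless n : (n <= OPT (edgeless n))%N.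
Proof.
rewrite -[leqLHS]card_ord -cardsT; apply: OPT_ge.
by apply/forall_inP => e; rewrite inE.
Qed.

Variables v m : nat.

(** [v] and [m] are plain numbers so that one formula serves every [n]. When [v < m], the edges are
    exactly the pairs joining [v] to a vertex of index at least [m]. *)
Definition star_edges n : {set {set 'I_n}} :=
  [set e : {set 'I_n} | [&& #|e| == 2, [exists i in e, i == v :> nat]
                          & [exists i in e, (m <= i)%N]]].

Lemma star_edges_simple n : [forall e in star_edges n, #|e| == 2].
Proof. by apply/forall_inP => e; rewrite inE => /and3P[]. Qed.

Definition star n : input n := Input (star_edges_simple n).

Lemma exists_earlier n (e : {set 'I_n}) (P : pred nat) :
  [exists i in @earlier n @: e, P (nat_of_ord i)]
  = [exists i in e, P (nat_of_ord i)].
Proof.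
apply/exists_inP/exists_inP => [[_ /imsetP[i ie ->]]|[i ie]] Pi.
  by exists i.
by exists (@earlier n i) => //; apply: imset_f.
Qed.

(** This makes the stars one growing input, so that acceptances carry over from each size to the
    next. *)
Lemma prefix_star n : Defs.prefix (star n.+1) = star n.
Proof.
apply: input_inj; apply/setP => e; rewrite !inE.
rewrite card_imset; last exact: earlier_inj.
by rewrite (exists_earlier n e (fun i => i == v)) (exists_earlier n e (leq m)).
Qed.

Lemma star_edgeless : star m = edgeless m.
Proof.
apply: input_inj; apply/setP => e; rewrite !inE.
apply/negP => /and3P[_ _ /exists_inP[i _]].
by rewrite leqNgt ltn_ord.
Qed.

(** Each edge contains [v], so the vertices of index at least [m], which exclude [v], are
    independent. *)
Lemma OPT_star n : (v < m)%N -> (n - m <= OPT (star n))%N.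
Proof.
move=> vm; apply: leq_trans (_ : #|~: [set i : 'I_n | (i < m)%N]| <= _)%N.
  by rewrite cardsCs setCK card_ord leq_sub2l ?card_below.
apply: OPT_ge; apply/forall_inP => e; rewrite inE => /and3P[_ + _].
case/exists_inP => i ie /eqP iv; apply/negP => /subsetP /(_ i ie).
by rewrite !inE iv vm.
Qed.

Variable A : late_accept_algorithm.
Hypothesis v_accepted : exists2 i, i \in accepted A (edgeless m) & i = v :> nat.

(** The first [m] arrivals look edgeless, so [v] is accepted by then; irrevocability keeps it. *)
Lemma star_accepts n :
  (m <= n)%N -> exists2 i, i \in accepted A (star n) & i = v :> nat.
Proof.
elim: n => [|n IHn]; rewrite leq_eqVlt => /predU1P[<-|]; rewrite ?star_edgeless //.
rewrite ltnS => /IHn[i iA iv]; exists (@earlier n i) => //.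
apply: (subsetP (accepted_irrevocable A (star n.+1))).
by rewrite prefix_star; apply: imset_f.
Qed.

(** An accepted [w] of index at least [m] would form an edge with the accepted [v]. *)
Lemma ALG_star n : (m <= n)%N -> (ALG A (star n) <= m)%N.
Proof.
move=> mn; have [i iA iv] := star_accepts n mn.
have vm : (v < m)%N by case: v_accepted => j _ <-.
apply: leq_trans (card_below n m); apply: subset_leq_card.
apply/subsetP => w wA; rewrite inE ltnNge; apply/negP => mw.
have /forall_inP /(_ [set i; w]) := accepted_independent A (star n).
rewrite subUset !sub1set iA wA inE; case/(_ _)/negP => //.
apply/and3P; split.
- rewrite cards2; suff -> : i != w by [].
  by apply/eqP => iw; move: mw; rewrite -iw iv leqNgt vm.
- by apply/exists_inP; exists i; rewrite ?set21 ?iv.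
- by apply/exists_inP; exists w; rewrite ?set22.
Qed.

End LowerBound.

Section UpperBound.

Variable k : nat.

(** Emptiness of the set held so far encodes the waiting state; the default [set0] prolongs the wait
    when no large enough independent set exists yet. *)
Fixpoint wait n : input n -> {set 'I_n} :=
  match n with
  | 0 => fun=> set0
  | n'.+1 => fun G =>
      let S := @earlier n' @: wait n' (Defs.prefix G) in
      if S == set0 then
        odflt set0 [pick T : {set 'I_n'.+1} | independent G T && (k <= #|T|)%N]
      else S
  end.

Lemma wait_independent n (G : input n) : independent G (wait n G).
Proof.
elim: n G => [|n IHn] G /=; first exact: independent0.
case: ifP => _; last exact: independent_earlier.
by case: pickP => [T /andP[]//|_] /=; apply: independent0.
Qed.

Lemma wait_irrevocable n (G : input n.+1) :
  @earlier n @: wait n (Defs.prefix G) \subset wait n.+1 G.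
Proof. by rewrite /=; case: ifP => // /eqP ->; apply: sub0set. Qed.

Definition wait_algorithm : late_accept_algorithm :=
  LateAcceptAlgorithm wait_independent wait_irrevocable.

Lemma wait_card n (G : input n) : wait n G != set0 -> (k <= #|wait n G|)%N.
Proof.
elim: n G => [|n IHn] G /=; first by rewrite eqxx.
case: ifP => [_|]; first by case: pickP => [T /andP[]//|_] /=; rewrite eqxx.
move=> /negbT S0 _; rewrite card_imset; last exact: earlier_inj.
by apply: IHn; apply: contraNneq S0 => ->; rewrite imset0.
Qed.

(** The search at the last arrival ranges over [G] itself, where a witness for [OPT G] qualifies, so
    it cannot fail. *)
Lemma ALG_wait n (G : input n) : (k <= OPT G)%N -> (k <= ALG wait_algorithm G)%N.
Proof.
rewrite /ALG /=; have [W0|W0 _] := eqVneq (wait n G) set0; last exact: wait_card.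
case: n G W0 => [|n] G.
  (* Without vertices [OPT] is 0, which forces [k = 0]. *)
  by move=> _ /leq_trans /(_ (OPT_le _ G)); rewrite leqn0 => /eqP ->.
move=> + /OPT_witness[S indS kS]; rewrite /=; case: ifP => [_|/negbT/eqP//].
case: pickP => [T /andP[]//|/(_ S)].
by rewrite indS kS.
Qed.

End UpperBound.

Theorem theorem3 (R : realType) :
  (forall A : late_accept_algorithm,
     exists b : R, 0 < b /\
       forall n : nat, (1 <= n)%N ->
       forall c : R, 0 <= c ->
         (forall G : input n, (OPT G)%:R <= c * (ALG A G)%:R) ->
         n%:R / b <= c)
  /\
  (forall b : R, 0 < b ->
     exists A : late_accept_algorithm, exists alpha : R,
       forall (n : nat) (G : input n), b <= n%:R ->
         (OPT G)%:R <= n%:R / b * (ALG A G)%:R + alpha).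
Proof.
split=> [A|b b_gt0].
- have [[m [v vA]]|none] :=
    pselect (exists m, exists v, v \in accepted A (edgeless m)); last first.
    (* Any positive [b] would do: no [c] is admissible, since [ALG] is 0 and [OPT] is positive on
       the edgeless graph. *)
    exists 1; split=> // n n_gt0 c _ /(_ (edgeless n)).
    suff -> : ALG A (edgeless n) = 0%N.
      rewrite mulr0 lern0 => /eqP OPT0.
      by have := leq_trans n_gt0 (OPT_edgeless n); rewrite OPT0.
    apply/eqP; rewrite cards_eq0; apply/set0Pn => -[v vA].
    by apply: none; exists n, v.
  have m_gt0 : (0 < m)%N by apply: leq_ltn_trans (ltn_ord v).
  (* The factor 2 comes from splitting [n] as [(n - m) + m] when [m <= n]: the star bounds [n - m]
     by [c * m], and [c >= 1] bounds [m] by [c * m]. *)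
  exists (2 * m%:R); split=> [|n n_gt0 c c_ge0 comp].
    by rewrite mulr_gt0 ?ltr0n.
  rewrite ler_pdivrMr ?mulr_gt0 ?ltr0n //.
  have c_ge1 : 1 <= c.
    rewrite -(@ler_pM2r _ n%:R) ?ltr0n // mul1r.
    apply: le_trans (_ : (OPT (edgeless n))%:R <= _).
      by rewrite ler_nat OPT_edgeless.
    apply: le_trans (comp _) _; rewrite ler_wpM2l // ler_nat.
    by rewrite -[leqRHS]card_ord; apply: max_card.
  have m_le : m%:R <= c * m%:R :> R by rewrite ler_peMl.
  have -> : c * (2 * m%:R) = c * m%:R + c * m%:R.
    by rewrite mulrCA mulr_natl mulr2n.
  have [nm|mn] := ltnP n m.
    apply: le_trans (_ : m%:R <= _); first by rewrite ler_nat ltnW.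
    by rewrite (le_trans m_le) // lerDl mulr_ge0.
  rewrite -(subnK mn) natrD lerD //.
  apply: le_trans (_ : (OPT (star v m n))%:R <= _).
    by rewrite ler_nat OPT_star.
  apply: le_trans (comp _) _; rewrite ler_wpM2l // ler_nat.
  by apply: ALG_star => //; exists v.
(* [k] is a natural number above the real [b], so [k] accepted vertices already make [n / b * ALG]
   at least [n]. *)
- pose k := Num.bound b; exists (wait_algorithm k), k%:R => n G _.
  have [kO|/ltnW Ok] := leqP k (OPT G); last first.
    apply: le_trans (_ : k%:R <= _); first by rewrite ler_nat.
    by rewrite lerDr mulr_ge0 ?divr_ge0 // ltW.
  apply: le_trans (_ : n%:R <= _); first by rewrite ler_nat OPT_le.
  apply: ler_wpDr => //; rewrite -mulrA ler_peMr // mulrC ler_pdivlMr // mul1r.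
  rewrite (le_trans (ltW (archi_boundP (ltW b_gt0)))) // ler_nat.
  exact: ALG_wait.
Qed.
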